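(* Let $B$ be a Banach algebra and let $a\in B$ and $d\in B$ be such that $d$ is regular and $a$ is invertible along $d$. Then: (i) $\lim_{t \to 0}(da + t 1)^{-1}d$ exists and equals $a^{\parallel d}$; (ii) $\lim_{t \to 0}d(ad + t 1)^{-1}$ exists and equals $a^{\parallel d}$.
   Context: Banach algebras are complex and have a unit $1$; limits are in norm as the scalar $t\neq 0$ tends to $0$ (part of the assertion being that the inverses involved exist for all sufficiently small $t\ne 0$). An element $d\in B$ is regular if there is $d^-\in B$ with $d=dd^-d$. For $a,d\in B$, $a$ is invertible along $d$ if there exists $b\in B$ such that $bab=b$, $bB=dB$ and $Bb=Bd$. Such $b$ is unique when it exists and is denoted $a^{\parallel d}$. *)

(* Defs.v *)
From HB Require Import structures.
From mathcomp Require Import all_boot all_order all_algebra.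
From mathcomp Require Import all_classical all_reals all_analysis.
From mathcomp Require Export complex.

Set Implicit Arguments.
Unset Strict Implicit.
Unset Printing Implicit Defensive.

Import Order.TTheory GRing.Theory Num.Theory.
Import numFieldNormedType.Exports.

Local Open Scope classical_set_scope.
Local Open Scope ring_scope.

(* Multiplication is a mixin on top of completeNormedModType, rather than a join
   of that structure with algType: such a join is rejected by Hierarchy Builder,
   because numDomainType already inherits from both normedZmodType and rings.
   The norm takes its values in K. The normalization |1| = 1 is not imposed. *)
HB.mixin Record CompleteNormedModule_isBanachAlgebra (K : numFieldType) B
    & CompleteNormedModule K B := {
  banach_one : B;
  banach_mul : B -> B -> B;
  banach_mulA : associative banach_mul;
  banach_mul1l : left_id banach_one banach_mul;
  banach_mul1r : right_id banach_one banach_mul;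
  banach_mulDl : left_distributive banach_mul +%R;
  banach_mulDr : right_distributive banach_mul +%R;
  banach_one_neq0 : banach_one != 0;
  banach_scaleAl : forall (k : K) (x y : B),
    k *: banach_mul x y = banach_mul (k *: x) y;
  banach_scaleAr : forall (k : K) (x y : B),
    k *: banach_mul x y = banach_mul x (k *: y);
  banach_normM : forall x y : B, `|banach_mul x y| <= `|x| * `|y|
}.

#[short(type="banachAlgebraType")]
HB.structure Definition BanachAlgebra (K : numFieldType) :=
  {B of CompleteNormedModule K B & CompleteNormedModule_isBanachAlgebra K B}.

Section BanachAlgebraInstances.
Variables (K : numFieldType) (B : banachAlgebraType K).

#[non_forgetful_inheritance]
HB.instance Definition _ := GRing.Zmodule_isNzRing.Build B
  (@banach_mulA K B) (@banach_mul1l K B) (@banach_mul1r K B)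
  (@banach_mulDl K B) (@banach_mulDr K B) (@banach_one_neq0 K B).

#[non_forgetful_inheritance]
HB.instance Definition _ :=
  GRing.Lmodule_isLalgebra.Build K B (@banach_scaleAl K B).

#[non_forgetful_inheritance]
HB.instance Definition _ :=
  GRing.Lalgebra_isAlgebra.Build K B (@banach_scaleAr K B).

Definition banach_is_inv (x y : B) : Prop := y * x = 1 /\ x * y = 1.

Definition banach_unit : {pred B} := fun x => `[< exists y, banach_is_inv x y >].

(* As GRing.inv requires, x^-1 = x when x is not invertible. *)
Definition banach_inv (x : B) : B := xget x [set y | banach_is_inv x y].

Fact banach_invP : {in banach_unit, forall x, banach_is_inv x (banach_inv x)}.
Proof.
move=> x /asboolP[y xy]; rewrite /banach_inv.
by case: xgetP => [z _ //|/(_ y)].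
Qed.

Fact banach_mulVr : {in banach_unit, left_inverse 1 banach_inv *%R}.
Proof. by move=> x /banach_invP[]. Qed.

Fact banach_divrr : {in banach_unit, right_inverse 1 banach_inv *%R}.
Proof. by move=> x /banach_invP[]. Qed.

Fact banach_unitP x y : y * x = 1 /\ x * y = 1 -> x \in banach_unit.
Proof. by move=> xy; apply/asboolP; exists y. Qed.

Fact banach_inv_out : {in [predC banach_unit], banach_inv =1 id}.
Proof.
move=> x /asboolP xN; rewrite /banach_inv.
by case: xgetP => // y _ xy; case: xN; exists y.
Qed.

#[non_forgetful_inheritance]
HB.instance Definition _ := GRing.NzRing_hasMulInverse.Build B
  banach_mulVr banach_divrr banach_unitP banach_inv_out.

Lemma banach_normrM (x y : B) : `|x * y| <= `|x| * `|y|.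
Proof. exact: banach_normM. Qed.

End BanachAlgebraInstances.

Section InverseAlong.
Variable B : unitRingType.
Implicit Types a b c d : B.

Definition regular d := exists d', d = d * d' * d.

Definition right_ideal d : set B := [set d * x | x in [set: B]].
Definition left_ideal d : set B := [set x * d | x in [set: B]].

Definition is_inverse_along a d b :=
  [/\ b * a * b = b, right_ideal b = right_ideal d
    & left_ideal b = left_ideal d].

Definition invertible_along a d := exists b, is_inverse_along a d b.

(* Equal to 0 when a is not invertible along d. *)
Definition inverse_along a d : B := xget 0 [set b | is_inverse_along a d b].

Lemma is_inverse_along_uniq a d b c :
  is_inverse_along a d b -> is_inverse_along a d c -> b = c.
Proof.
case=> bab bR bL [cac cR cL].
have [x _ bx] : right_ideal b c.
  by rewrite bR -cR; exists 1; rewrite ?mulr1.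
have [y _ yc] : left_ideal c b.
  by rewrite cL -bL; exists 1; rewrite ?mul1r.
have bac : b * a * c = c by rewrite -bx mulrA bab.
by rewrite -bac -yc -!mulrA (mulrA c) cac.
Qed.

Lemma inverse_alongP a d :
  invertible_along a d -> is_inverse_along a d (inverse_along a d).
Proof. by case=> b db; rewrite /inverse_along; case: xgetP => [c _ //|/(_ b)]. Qed.

End InverseAlong.

(* Main.v *)
(** Write [b] for the inverse of [a] along [d]. Then [p = b a] is an idempotent
    with [p d = d], and [c = d a] has an inverse [w] in the corner ring [p B p],
    with [w d = b]. For small [t <> 0] the element [c + t] splits along [p] and
    [1 - p], so that [(c + t)^-1 = w (1 + t w)^-1 + t^-1 (1 - p)]; since
    [(1 - p) d = 0], the singular part disappears from [(c + t)^-1 d], which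
    equals [w (1 + t w)^-1 d] and tends to [w d = b]. The second limit reduces to
    the first through [d (a d + t)^-1 = (d a + t)^-1 d]. *)
Require Import Defs.
From mathcomp Require Import all_boot all_order all_algebra.
From mathcomp Require Import all_classical all_reals all_analysis.

Import Order.TTheory GRing.Theory Num.Theory.
Import numFieldNormedType.Exports.
Local Open Scope classical_set_scope.
Local Open Scope ring_scope.

(** Equality of the ideals puts [d] in both [b B] and [B b], so [b a b = b] passes from [b] to [d]
    on either side. *)
Lemma inverse_along_absorb (A : unitRingType) (a d b : A) :
  is_inverse_along a d b -> b * a * d = d /\ d * a * b = d.
Proof.
case=> bab bR bL.
have [u _ bu] : right_ideal b d by rewrite bR; exists 1; rewrite ?mulr1.
have [v _ vb] : left_ideal b d by rewrite bL; exists 1; rewrite ?mul1r.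
by split; [rewrite -bu mulrA bab | rewrite -vb -!mulrA (mulrA b) bab].
Qed.

Lemma inverse_along_corner (A : unitRingType) (a d b : A) :
  is_inverse_along a d b ->
  exists w, [/\ d * a * w = b * a, w * (d * a) = b * a,
                b * a * w = w, w * (b * a) = w & w * d = b].
Proof.
move=> db; have [bad dab] := inverse_along_absorb _ _ _ _ db.
case: db => bab bR bL.
have [x _ dx] : right_ideal d b by rewrite -bR; exists 1; rewrite ?mulr1.
have [y _ yd] : left_ideal d b by rewrite -bL; exists 1; rewrite ?mul1r.
pose p := b * a; pose c := d * a.
have pp : p * p = p by rewrite /p mulrA bab.
have cp : c * p = c by rewrite /c /p mulrA dab.
have pc : p * c = c by rewrite /c mulrA bad.
have yc : y * c = p by rewrite /c mulrA yd.
have cr : c * (b * x * a) = p by rewrite /c !mulrA dab dx.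
(* [y] is a left and [b x a] a right inverse of [c] relative to [p]; as in any monoid, their
   compressions to the corner of [p] agree, which makes the witness below two-sided. *)
have wE : p * y * p = p * (b * x * a) * p.
  have pr : p * y * p = p * (b * x * a).
    by rewrite -[X in _ * X]cr mulrA -(mulrA p y) yc pp.
  by rewrite -pr -[RHS]mulrA pp.
exists (p * y * p); split.
- by rewrite -/c wE 2!mulrA cp cr pp.
- by rewrite -mulrA pc -mulrA yc.
- by rewrite -/p 2!mulrA pp.
- by rewrite -/p -[LHS]mulrA pp.
- by rewrite -mulrA bad -mulrA yd bab.
Qed.

Section ShiftedInverse.
Variables (K : fieldType) (A : unitAlgType K).
Implicit Types (a d c p w : A) (t : K).

(** On the corner of [p], the shift is [c + t p = c (1 + t w)], inverted by [w (1 + t w)^-1]; on the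
    complementary corner it is the scalar [t]. *)
Lemma shift_unit_inv c p w t : t != 0 -> 1 + t *: w \is a GRing.unit ->
    c * w = p -> w * c = p -> p * w = w -> w * p = w -> p * c = c -> c * p = c ->
  c + t *: 1 \is a GRing.unit /\
  (c + t *: 1)^-1 = w * (1 + t *: w)^-1 + t^-1 *: (1 - p).
Proof.
move=> t0 zU cw wc pw wp pc cp.
set z := (1 + t *: w)^-1.
have wz : w * z = z * w.
  apply: commrV; apply: commrD; first exact: commr1.
  by rewrite /GRing.comm -scalerAr -scalerAl.
have R1 : (c + t *: 1) * (w * z + t^-1 *: (1 - p)) = 1.
  rewrite mulrDl !mulrDr !mulrA cw -scalerAr mulrBr mulr1 cp subrr scaler0 addr0.
  rewrite -!scalerAl !mul1r scalerA divff // scale1r.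
  (* Writing [p = p * 1] and [w = p * w] merges the first two terms into [p (1 + t w) z = p]. *)
  rewrite addrA scalerAl -mulrDl -{1}(mulr1 p) -{1}pw scalerAr -mulrDr.
  by rewrite -mulrA mulrV // mulr1 addrC subrK.
have R2 : (w * z + t^-1 *: (1 - p)) * (c + t *: 1) = 1.
  rewrite mulrDr !mulrDl wz -mulrA wc -scalerAl mulrBl mul1r pc subrr scaler0 addr0.
  rewrite -!scalerAr !mulr1 scalerA divff // scale1r.
  rewrite addrA scalerAr -mulrDr -{1}(mul1r p) -{1}wp scalerAl -mulrDl.
  by rewrite mulrA mulVr // mul1r addrC subrK.
have U : c + t *: 1 \is a GRing.unit by apply/unitrP; exists (w * z + t^-1 *: (1 - p)).
by split=> //; apply: (mulrI U); rewrite mulrV ?R1.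
Qed.

(* Jacobson's lemma. *)
Lemma shift_unitC a d t : t != 0 ->
  d * a + t *: 1 \is a GRing.unit -> a * d + t *: 1 \is a GRing.unit.
Proof.
move=> t0 U; set X := (d * a + t *: 1)^-1.
apply/unitrP; exists (t^-1 *: (1 - a * X * d)); split.
- rewrite -scalerAl mulrBl mul1r (_ : a * X * d * _ = a * d).
    by rewrite addrC addKr scalerA mulVf // scale1r.
  rewrite -(mulrA _ d) (_ : d * _ = (d * a + t *: 1) * d).
    by rewrite -!mulrA mulKr.
  by rewrite mulrDr mulrDl mulrA -scalerAr -scalerAl mulr1 mul1r.
- rewrite -scalerAr mulrBr mulr1 (_ : _ * (a * X * d) = a * d).
    by rewrite addrC addKr scalerA mulVf // scale1r.
  rewrite !mulrA (_ : _ * a = a * (d * a + t *: 1)).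
    by rewrite mulrK.
  by rewrite mulrDr mulrDl mulrA -scalerAr -scalerAl mulr1 mul1r.
Qed.

(** Cancel the two units in [d (a d + t) = (d a + t) d]. *)
Lemma shift_invC a d t :
    d * a + t *: 1 \is a GRing.unit -> a * d + t *: 1 \is a GRing.unit ->
  d * (a * d + t *: 1)^-1 = (d * a + t *: 1)^-1 * d.
Proof.
move=> U V; apply: (mulrI U); apply: (mulIr V).
rewrite mulVKr // -!mulrA mulVr // mulr1.
by rewrite mulrDr mulrDl mulrA -scalerAr -scalerAl mulr1 mul1r.
Qed.

End ShiftedInverse.

(** Norms on [B] are valued in [R[i]]; a nonnegative element there is real, so the Archimedean
    property of [R] applies to its real part. *)
Lemma complex_lt_expn2 (R : realType) (x : R[i]) :
  0 <= x -> exists n, x < 2 ^+ n.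
Proof.
move=> x0; exists (Num.bound (complex.Re x)).
rewrite -(RRe_real (ger0_real x0)).
have r0 : 0 <= complex.Re x by move: x0; rewrite lecE => /andP[].
have := archi_boundP r0; move: (Num.bound _) => n xn.
have -> : 2 ^+ n = (2 ^+ n : R)%:C%C :> R[i] by rewrite rmorphXn rmorph_nat.
rewrite ltcR (lt_le_trans xn) // -natrX ler_nat.
exact/ltnW/ltn_expl.
Qed.

Section BanachLimits.
Variables (K : numFieldType) (B : banachAlgebraType K).

Lemma banach_cvgM {T : Type} (F : set_system T) {FF : Filter F}
    (f : T -> B) (x y l : B) :
  f @ F --> l -> x * f t * y @[t --> F] --> x * l * y.
Proof.
move=> fl; apply/cvgrPdist_le => e e0.
(* The [+ 1] keeps the divisor positive when [x] or [y] is zero. *)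
have C0 : 0 < `|x| * `|y| + 1 by rewrite ltr_wpDl // mulr_ge0.
move/cvgrPdist_le : fl => /(_ _ (divr_gt0 e0 C0)); apply: filterS => t.
rewrite ler_pdivlMr // => le.
rewrite -mulrBl -mulrBr (le_trans (banach_normrM _ _)) //.
rewrite (le_trans (ler_wpM2r _ (banach_normrM _ _))) //.
apply: le_trans le; rewrite mulrAC mulrC ler_wpM2l // lerDl //.
Qed.

End BanachLimits.

Section Neumann.
Variables (R : realType) (B : banachAlgebraType R[i]).
Implicit Types u w : B.

Let S u n := \sum_(i < n) u ^+ i.

Let S_recl u n : S u n.+1 = 1 + u * S u n.
Proof.
rewrite /S big_ord_recl expr0 mulr_sumr; congr (_ + _).
by apply: eq_bigr => i _; rewrite /bump /= exprS.
Qed.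

Let S_comm u n : u * S u n = S u n * u.
Proof.
by rewrite /S mulr_sumr mulr_suml; apply: eq_bigr => i _; rewrite -exprS exprSr.
Qed.

Let S_add u N k : S u (N + k) = S u N + u ^+ N * S u k.
Proof.
rewrite /S big_split_ord /= mulr_sumr; congr (_ + _).
by apply: eq_bigr => i _; rewrite exprD.
Qed.

(** The bound is the fixed point of [r = |1| + r / 2]; [|1|] stays because the norm is not
    normalized. *)
Let S_bound u n : `|u| <= 2^-1 -> `|S u n| <= 2 * `|1 : B|.
Proof.
move=> u2; elim: n => [|n IH]; first by rewrite /S big_ord0 normr0 mulr_ge0.
rewrite S_recl (le_trans (ler_normD _ _)) // mulr2n mulrDl mul1r lerD2l.
rewrite (le_trans (banach_normrM _ _)) //.
rewrite (le_trans (ler_pM _ _ u2 IH)) // mulrA mulVf ?mul1r ?lexx ?pnatr_eq0 //.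
Qed.

(** Carrying the factor [y] avoids an extra [|1|] at [N = 0]. *)
Let expr_bound u N (y : B) : `|u| <= 2^-1 -> `|u ^+ N * y| <= `|y| / 2 ^+ N.
Proof.
move=> u2; elim: N => [|N IH]; first by rewrite expr0 mul1r divr1.
rewrite exprS -mulrA (le_trans (banach_normrM _ _)) //.
rewrite (le_trans (ler_pM _ _ u2 IH)) // exprS invfM mulrCA lexx //.
Qed.

Let S_cvg u : `|u| <= 2^-1 -> cvg (S u @ \oo).
Proof.
move=> u2; apply: cauchy_cvg; apply: cauchy_exP => e e0.
(* Past [N], the partial sums differ from [S u N] by [u ^+ N * S u k], of norm at most
   [2 |1| / 2 ^+ N < e]. *)
have [|N HN] := @complex_lt_expn2 R (2 * `|1 : B| / e).
  by rewrite divr_ge0 ?mulr_ge0 // ltW.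
exists (S u N); exists N => // m /= /subnKC <-.
rewrite -ball_normE /= distrC S_add addrC addKr.
rewrite (le_lt_trans (expr_bound _ _ _ u2)) // ltr_pdivrMr ?exprn_gt0 //.
rewrite (le_lt_trans (S_bound _ _ u2)) //.
by rewrite -ltr_pdivrMl // mulrC.
Qed.

(** The sum [s] of the Neumann series is the inverse: the recursion on partial sums gives
    [s = 1 + u s = 1 + s u] in the limit. *)
Lemma unit_1B u : `|u| <= 2^-1 -> 1 - u \is a GRing.unit.
Proof.
move=> u2; have /cvg_ex[s /= Ss] := S_cvg _ u2.
have Ss1 : (fun n => S u n.+1) @ \oo --> s by have := Ss; rewrite -cvg_shiftS.
(* The idle factor [1] gives the two-sided shape required by [banach_cvgM]. *)
have sl : s = 1 + u * s * 1.
  apply: (norm_cvg_unique Ss1).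
  have -> : (fun n => S u n.+1) = (fun n => 1 + u * S u n * 1).
    by apply/funext => n; rewrite S_recl mulr1.
  by apply: cvgD; [exact: cvg_cst | exact: banach_cvgM].
have sr : s = 1 + 1 * s * u.
  apply: (norm_cvg_unique Ss1).
  have -> : (fun n => S u n.+1) = (fun n => 1 + 1 * S u n * u).
    by apply/funext => n; rewrite S_recl S_comm mul1r.
  by apply: cvgD; [exact: cvg_cst | exact: banach_cvgM].
rewrite mulr1 in sl; rewrite mul1r in sr.
apply/unitrP; exists s; rewrite mulrBr mulrBl mulr1 mul1r.
by split; [rewrite {1}sr | rewrite {1}sl]; rewrite addrK.
Qed.

(** From [z = 1 + u z] follows [|z| <= |1| + |z| / 2], with no return to the series. *)
Lemma norm_inv_1B u : `|u| <= 2^-1 -> `|(1 - u)^-1| <= 2 * `|1 : B|.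
Proof.
move=> u2; set z := (1 - u)^-1.
have zE : z = 1 + u * z.
  by rewrite -[1](mulrV (unit_1B _ u2)) mulrBl mul1r subrK.
have : `|z| <= `|1 : B| + 2^-1 * `|z|.
  rewrite {1}zE (le_trans (ler_normD _ _)) // lerD2l.
  by rewrite (le_trans (banach_normrM _ _)) // ler_wpM2r.
rewrite -lerBlDr -{1}(mul1r `|z|) -mulrBl.
rewrite (_ : 1 - 2^-1 = 2^-1 :> R[i]); last by rewrite {1}(splitr 1) mul1r addrK.
by rewrite ler_pdivrMl.
Qed.

Lemma near0_scale_small w (e : R[i]) : 0 < e ->
  \forall t \near (0 : R[i]^o)^', `|t *: w| <= e.
Proof.
move=> e0; have C0 : 0 < `|w| + 1 by rewrite ltr_wpDl.
have := @dnbhs0_le _ (R[i]^o) _ (divr_gt0 e0 C0); apply: filterS => t.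
rewrite ler_pdivlMr // => le; rewrite normrZ (le_trans _ le) //.
by rewrite ler_wpM2l // lerDl.
Qed.

Lemma near0_unit_1DZ w :
  \forall t \near (0 : R[i]^o)^', 1 + t *: w \is a GRing.unit.
Proof.
have := near0_scale_small w 2^-1; rewrite invr_gt0 ltr0n => /(_ isT).
by apply: filterS => t tw; rewrite -(opprK (t *: w)) unit_1B // normrN.
Qed.

Lemma cvg_inv_1DZ w : (1 + t *: w)^-1 @[t --> (0 : R[i]^o)^'] --> (1 : B).
Proof.
apply/cvgrPdist_le => e e0.
have C0 : 0 < 2 * `|1 : B| by rewrite mulr_gt0 // normr_gt0 oner_eq0.
have h0 : (0 : R[i]) < 2^-1 by rewrite invr_gt0 ltr0n.
near=> t.
have tw : `|- (t *: w)| <= 2^-1.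
  by rewrite normrN; near: t; exact: near0_scale_small.
have := norm_inv_1B _ tw; rewrite opprK => zb.
have := unit_1B _ tw; rewrite opprK => zU.
(* With [z = (1 + t w)^-1], the difference [1 - z] is [t w z], and [|z| <= 2 |1|]; hence the
   threshold [e / (2 |1|)] for [|t w|]. *)
rewrite -{1}(mulrV zU) mulrDl mul1r addrC addKr.
rewrite (le_trans (banach_normrM _ _)) //.
rewrite (le_trans (ler_wpM2l (normr_ge0 _) zb)) //.
rewrite -ler_pdivlMr //; near: t; apply: near0_scale_small; exact: divr_gt0.
Unshelve. all: by end_near.
Qed.

End Neumann.

Theorem theorem5p1 (R : realType) (B : banachAlgebraType R[i]) (a d : B)
    (hd : regular d) (had : invertible_along a d) :
  [/\ \forall t \near (0 : R[i]^o)^', d * a + t *: 1 \is a GRing.unit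
    & (d * a + t *: 1)^-1 * d @[t --> (0 : R[i]^o)^'] --> inverse_along a d] /\
  [/\ \forall t \near (0 : R[i]^o)^', a * d + t *: 1 \is a GRing.unit
    & d * (a * d + t *: 1)^-1 @[t --> (0 : R[i]^o)^'] --> inverse_along a d].
Proof.
have db := inverse_alongP had; set b := inverse_along a d in db *.
have [w [cw wc pw wp wd]] := inverse_along_corner _ _ _ _ db.
have [bad dab] := inverse_along_absorb _ _ _ _ db.
(* One punctured neighbourhood serves both limits, and the expression obtained there has no
   [t^-1]. *)
have key : \forall t \near (0 : R[i]^o)^', [/\ d * a + t *: 1 \is a GRing.unit,
    a * d + t *: 1 \is a GRing.unit &
    (d * a + t *: 1)^-1 * d = w * (1 + t *: w)^-1 * d].
  near=> t.
  have t0 : t != 0 by near: t; exact: nbhs_dnbhs_neq.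
  have zU : 1 + t *: w \is a GRing.unit by near: t; exact: near0_unit_1DZ.
  have [||U ->] := shift_unit_inv _ _ _ _ _ _ t0 zU cw wc pw wp.
  - by rewrite mulrA bad.
  - by rewrite mulrA dab.
  split=> //; first exact: shift_unitC.
  (* The singular term dies because [(1 - b a) d = 0]. *)
  by rewrite mulrDl -scalerAl mulrBl mul1r bad subrr scaler0 addr0.
have lim : w * (1 + t *: w)^-1 * d @[t --> (0 : R[i]^o)^'] --> b.
  have -> : b = w * 1 * d by rewrite mulr1 wd.
  exact: banach_cvgM (cvg_inv_1DZ _ _ _).
split; split.
- by apply: filterS key => t [].
- by apply: cvg_trans lim; apply: near_eq_cvg; apply: filterS key => t [].
- by apply: filterS key => t [].
- apply: cvg_trans lim; apply: near_eq_cvg; apply: filterS key => t [U V <-].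
  by rewrite shift_invC.
Unshelve. all: by end_near.
Qed.
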